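(* Let $I$ be an instance of Min BP that has an equivalent graph $G$. Then $\mathrm{OPT}(I)\ge \omega(G)$.
   Context: Min BP: an instance consists of a set $A=\{a_1,\ldots,a_n\}$ of $n$ items, each item $a_j$ having a positive rational size $s_j$, and $n$ bins. The task is to find $n$ pairwise disjoint (possibly empty) subsets $A_1,\ldots,A_n$ of $A$ with union $A$, such that the sum of sizes in each subset is at most $1$ and the number of non-empty subsets is minimized. $\mathrm{OPT}(I)$ denotes this minimum number. A Min BP instance $I$ and a graph $G=(V,E)$ are equivalent if there is a bijection $f:A\to V$ such that for every $A'\subseteq A$ the characteristic vector $(x_1,\ldots,x_n)$ of $A'$ satisfies $s_1x_1+\cdots+s_nx_n\le 1$ if and only if $f(A')$ is an independent set of $G$. $\omega(G)$ is the size of a largest clique of $G$. *)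

(* Defs.v *)
From mathcomp Require Import all_boot all_order all_algebra.

Set Implicit Arguments.
Unset Strict Implicit.
Unset Printing Implicit Defensive.

Import Order.TTheory GRing.Theory Num.Theory.

(* The item a_j is represented by its index j : 'I_n. *)
Record bp_instance := BPInstance {
  bp_items : nat;
  bp_size : 'I_bp_items -> rat;
  bp_size_gt0 : forall j, (0 < bp_size j)%R }.

Section MinBP.

Variable I : bp_instance.
Local Notation n := (bp_items I).

(* A packing assigns to each of the n bins the set of items it receives. *)
Definition packing := {ffun 'I_n -> {set 'I_n}}.

Definition feasible (P : packing) : bool :=
  [&& [forall i, forall j, (i != j) ==> [disjoint P i & P j]],
      \bigcup_i P i == [set: 'I_n]
    & [forall i, (\sum_(j in P i) bp_size j <= 1)%R]].

Definition nb_bins (P : packing) : nat := #|[set i | P i != set0]|.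

Definition one_item_per_bin : packing := [ffun i => [set i]].

(* [arg min] needs a default packing, returned when that packing is itself
   infeasible. Sizes being positive, this happens only if some item has size
   greater than 1, that is, only if there is no feasible packing at all: see
   [OPT_attained] and [OPT_le] below. *)
Definition OPT : nat :=
  nb_bins [arg min_(P < one_item_per_bin | feasible P) nb_bins P].

Lemma one_item_per_bin_feasible (P : packing) :
  feasible P -> feasible one_item_per_bin.
Proof.
case/and3P=> _ /eqP covP /forallP capP; apply/and3P; split.
- apply/forallP=> i; apply/forallP=> j; apply/implyP=> neq_ij.
  by rewrite !ffunE disjoints1 inE.
- apply/eqP/setP=> j; rewrite inE; apply/bigcupP.
  by exists j; rewrite // ffunE inE.
apply/forallP=> j; rewrite ffunE big_set1.
have /bigcupP[i _ Pij] : j \in \bigcup_i P i by rewrite covP inE.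
apply: le_trans (capP i); rewrite (bigD1 j) //= lerDl.
by apply: sumr_ge0 => k _; apply/ltW/bp_size_gt0.
Qed.

Lemma OPT_attained (P : packing) :
  feasible P -> exists2 Q : packing, feasible Q & nb_bins Q = OPT.
Proof.
move=> /one_item_per_bin_feasible f1; rewrite /OPT.
by case: arg_minnP => // Q fQ _; exists Q.
Qed.

Lemma OPT_le (P : packing) : feasible P -> OPT <= nb_bins P.
Proof.
move=> fP; rewrite /OPT.
by case: arg_minnP => [|Q _]; [apply: one_item_per_bin_feasible fP | apply].
Qed.

End MinBP.

Record sgraph := SGraph {
  vertex :> finType;
  adj : rel vertex;
  adj_sym : symmetric adj;
  adj_irrefl : irreflexive adj }.

Section Graph.

Variable G : sgraph.

Definition independent_set (S : {set G}) : bool :=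
  [forall x in S, forall y in S, ~~ adj x y].

Definition clique (S : {set G}) : bool :=
  [forall x in S, forall y in S, (x != y) ==> adj x y].

Definition omega : nat := \max_(S : {set G} | clique S) #|S|.

End Graph.

(* [(j \in A')%:R] is the j-th entry of the characteristic vector of [A']. *)
Definition bp_equivalent (I : bp_instance) (G : sgraph) : Prop :=
  exists2 f : 'I_(bp_items I) -> G, bijective f &
    forall A' : {set 'I_(bp_items I)},
      (\sum_j bp_size j * (j \in A')%:R <= 1)%R <-> independent_set (f @: A').

(* Main.v *)
Require Import Defs.
From mathcomp Require Import all_boot all_order all_algebra.

(** A bin of a feasible packing corresponds to an independent set of [G], which
    meets a clique in at most one vertex; so sending each vertex of a clique to
    the bin of its item is injective into the non-empty bins. *)

Import GRing.Theory.

(** Bridges the characteristic-vector sums of [bp_equivalent] and the capacity constraint of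
    [feasible]. *)
Lemma sum_size_charvec (I : bp_instance) (A : {set 'I_(bp_items I)}) :
  (\sum_j bp_size j * (j \in A)%:R = \sum_(j in A) bp_size j)%R.
Proof.
rewrite [RHS]big_mkcond; apply: eq_bigr => j _.
by case: (j \in A); rewrite (mulr1, mulr0).
Qed.

Lemma independent_set1 (G : sgraph) (x : G) : independent_set [set x].
Proof.
apply/forall_inP => y /set1P->; apply/forall_inP => z /set1P->.
by rewrite adj_irrefl.
Qed.

(** Two distinct common vertices would be both adjacent and non-adjacent. *)
Lemma clique_independent_eq (G : sgraph) (S T : {set G}) (x y : G) :
  clique S -> independent_set T ->
  x \in S -> y \in S -> x \in T -> y \in T -> x = y.
Proof.
move=> /forall_inP clS /forall_inP indT xS yS xT yT.
have /forall_inP/(_ _ yS) := clS _ xS; have /forall_inP/(_ _ yT) := indT _ xT.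
by move=> /negPf->; rewrite implybF negbK => /eqP.
Qed.

(* An equivalent graph has independent singletons, so no item exceeds a bin. *)
Lemma bp_equivalent_feasible (I : bp_instance) (G : sgraph) :
  bp_equivalent I G -> feasible (one_item_per_bin I).
Proof.
case=> f _ eqv; apply/and3P; split.
- apply/forallP=> i; apply/forallP=> j; apply/implyP=> neq_ij.
  by rewrite !ffunE disjoints1 inE.
- apply/eqP/setP=> j; rewrite inE; apply/bigcupP.
  by exists j; rewrite // ffunE inE.
apply/forallP=> i; rewrite ffunE -sum_size_charvec; apply/eqv.
by rewrite imset_set1 independent_set1.
Qed.

Lemma clique_le_nb_bins (I : bp_instance) (G : sgraph) (P : packing I)
    (S : {set G}) :
  bp_equivalent I G -> feasible P -> clique S -> #|S| <= nb_bins P.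
Proof.
case=> f [g fK gK] eqv /and3P[_ /eqP covP /forallP capP] clS.
(* As the bins cover all items, finite choice yields a map [b] from each item to a bin holding
   it. *)
have /fin_all_exists[b bP] : forall j, exists i, j \in P i.
  move=> j; have /bigcupP[i _ Pij] : j \in \bigcup_i P i by rewrite covP inE.
  by exists i.
have inj_bg : {in S &, injective (b \o g)}.
  move=> x y xS yS /= eq_b.
  have indP : independent_set (f @: P (b (g x))).
    by apply/eqv; rewrite sum_size_charvec.
  apply: (clique_independent_eq _ _ _ _ _ clS indP) => //.
    by rewrite -[X in X \in _]gK imset_f.
  by rewrite eq_b -[X in X \in _]gK imset_f.
(* Each bin in the image of [S] is non-empty: [b (g x)] holds [g x]. *)
rewrite -(card_in_imset inj_bg); apply/subset_leq_card/subsetP => _ /imsetP[x _ ->].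
by rewrite inE; apply/set0Pn; exists (g x).
Qed.

Theorem theorem3p35 (I : bp_instance) (G : sgraph) :
  bp_equivalent I G -> omega G <= OPT I.
Proof.
(* Feasibility of [one_item_per_bin] ensures that [OPT] is the bin count of a feasible packing, not
   a default value. *)
move=> eqIG; have [Q fQ <-] := OPT_attained (bp_equivalent_feasible _ _ eqIG).
by apply/bigmax_leqP => S; apply: clique_le_nb_bins eqIG fQ.
Qed.
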